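(* Let $n\in\mathbb{N}$, let $\mathscr{F}$ be a maximal weakly separated family of triangles in $[n]$, and let $x\in[n]$. Let $v_1,\dots,v_r$ be those vertices of the graph $G(\mathscr{F}_x)$ that have degree at least $2$. Then the full (induced) subgraph of $G(\mathscr{F}_x)$ on $v_1,\dots,v_r$ is a triangulation of an $r$-gon. Moreover, all other vertices of $G(\mathscr{F}_x)$ have degree $1$, and their edge connects to one of the $v_i$.
   Context: Let $[n]=\{1,\dots,n\}$. A tuple $(a_1,\dots,a_r)$, $r\ge 3$, of pairwise distinct elements of $[n]$ is cyclically ordered if $a_1<\dots<a_r$ or there is $2\le i\le r$ with $a_i<a_{i+1}<\dots<a_r<a_1<\dots<a_{i-1}$. A triangle is a subset of $[n]$ with exactly $3$ elements. Two triangles $A,B$ are crossing if there are $a,c\in A\setminus B$ and $b,d\in B\setminus A$ such that $(a,b,c,d)$ is cyclically ordered; otherwise they are weakly separated. A weakly separated family of triangles is a set of pairwise non-crossing triangles in $[n]$; it is maximal if it is not properly contained in another weakly separated family of triangles in $[n]$. For $x\in[n]$ put $\mathscr{F}_x=\{C\in\mathscr{F}\mid x\in C\}$. The graph $G(\mathscr{F}_x)$ has as vertices the elements of $[n]\setminus\{x\}$ that occur in some triangle of $\mathscr{F}_x$, and has an edge between $a$ and $b$ for every triangle $\{x,a,b\}\in\mathscr{F}_x$. A graph equipped with a cyclic order on its vertices (here the one inherited from $[n]$) is a triangulation of a polygon (of an $r$-gon if it has $r$ vertices) if (i) neighbouring vertices in the cyclic order are joined by an edge, (ii) no two edges cross each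 other (vertices being placed in cyclic order on a circle and edges drawn as chords), and (iii) all inner regions of the graph are triangles. By convention, a triangulation of a $2$-gon is two vertices joined by an edge.
   Formalization: Proved for n ≥ 4. For n = 3 the claim fails: with F = {{1,2,3}}, G(F_1) is one edge whose two ends have degree 1, so there are no v_i to connect to; for n ≤ 2 there are no triangles, r = 0, and there is no 0-gon to triangulate. *)

(* Defs.v *)
From mathcomp Require Import all_boot.

Set Implicit Arguments.
Unset Strict Implicit.
Unset Printing Implicit Defensive.

(* The ground set [n] = {1, ..., n} is represented by 'I_n = {0, ..., n-1};
   only the order of its elements matters. *)

(* Rotating (a_1, ..., a_r) by i.-1 gives (a_i, ..., a_r, a_1, ..., a_(i-1));
   strict increase also forces the entries to be pairwise distinct. *)
Definition cyclically_ordered n (s : seq 'I_n) : bool :=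
  (3 <= size s) &&
  [exists i : 'I_(size s), sorted (fun a b : 'I_n => a < b) (rot i s)].

Definition crossing n (A B : {set 'I_n}) : bool :=
  [exists a in A :\: B, exists c in A :\: B,
   exists b in B :\: A, exists d in B :\: A,
     cyclically_ordered [:: a; b; c; d]].

Definition triangle n (A : {set 'I_n}) : bool := #|A| == 3.

Definition ws_family n (F : {set {set 'I_n}}) : bool :=
  [forall A in F, triangle A] &&
  [forall A in F, forall B in F, ~~ crossing A B].

Definition maximal_ws_family n (F : {set {set 'I_n}}) : bool :=
  maxset (@ws_family n) F.

(* Graphs on a subset of [n]; the vertices carry the cyclic order of [n]. *)
Record graph (n : nat) := Graph { vert : {set 'I_n}; adj : rel 'I_n }.

Definition star n (F : {set {set 'I_n}}) (x : 'I_n) : {set {set 'I_n}} :=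
  [set C in F | x \in C].

(* The graph G(F_x). *)
Definition link_graph n (F : {set {set 'I_n}}) (x : 'I_n) : graph n :=
  Graph [set a | a != x & [exists C in star F x, a \in C]]
        (fun a b => uniq [:: x; a; b] && ([set x; a; b] \in star F x)).

Definition degree n (G : graph n) (v : 'I_n) : nat :=
  #|[set w in vert G | adj G v w]|.

Definition deg_ge2 n (G : graph n) : {set 'I_n} :=
  [set v in vert G | 2 <= degree G v].

Definition induced n (G : graph n) (W : {set 'I_n}) : graph n :=
  Graph (vert G :&: W) (fun a b => [&& a \in W, b \in W & adj G a b]).

(* enum W lists W increasingly, so this says that cyclically neighbouring
   elements of W (the last and the first included) are adjacent. *)
Definition boundary_joined n (G : graph n) (W : {set 'I_n}) : bool :=
  cycle (adj G) (enum W).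

Definition noncrossing n (G : graph n) : Prop :=
  forall a b c d : 'I_n,
    adj G a b -> adj G c d -> ~~ cyclically_ordered [:: a; c; b; d].

(* An inner region of a chord diagram without crossings is the interior of the
   convex hull of a set W of at least 3 vertices such that all sides of this
   hull are edges and no edge runs through its interior.  The chord ab meets
   the interior of the hull of W iff W has points strictly on both sides of ab,
   i.e. iff (a, w, b, w') is cyclically ordered for some w, w' in W. *)
Definition inner_region n (G : graph n) (W : {set 'I_n}) : Prop :=
  [/\ W \subset vert G, 3 <= #|W|, boundary_joined G W &
      forall a b w w' : 'I_n, adj G a b -> w \in W -> w' \in W ->
        ~~ cyclically_ordered [:: a; w; b; w']].

(* Polygons have at least 3 vertices, except for the 2-gon; for r = 2 the
   conditions below reduce to two vertices joined by an edge. *)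
Definition polygon_triangulation n (r : nat) (G : graph n) : Prop :=
  [/\ 2 <= r, #|vert G| = r, boundary_joined G (vert G), noncrossing G &
      forall W : {set 'I_n}, inner_region G W -> #|W| = 3].

(* Main.v *)
Require Import Defs.
From mathcomp Require Import all_boot.
From mathcomp Require Import zify.

Set Implicit Arguments.
Unset Strict Implicit.
Unset Printing Implicit Defensive.

(** Fix x and write U for the set of points v <> x such that the pair {x, v}
    crosses no member of F.  The whole statement is governed by U: it turns out
    to be the set of vertices of degree at least 2 in the link graph of x, and
    inside U the family F exerts no constraint except through the link itself.

    Read positions cyclically from x, so that x comes first.  A member B of F
    that omits x and v crosses {x, v} iff B has points on both sides of v.

    - If a and b lie in U, the triangle {x, a, b} crosses no member of F that
      omits x.  Indeed, a crossing through x would be a crossing of {x, a} or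
      {x, b}, and if the chord ab separates two points of B, then so does xa or
      xb.  By maximality of F, the pair ab is therefore an edge of the link as
      soon as no link edge crosses it (compatible_adj).

    - If v <> x lies outside U, some B in F has points on both sides of v, and
      an edge vw of the link must end in B, at an endpoint of every pair of
      points of B that has v between them (adj_side).  As B has three points,
      one side of v contains exactly one of them, and w is that point; so v has
      degree at most 1.  If w were outside U as well, the two triangles
      witnessing this for v and w would cross each other.  Finally no point of
      U lies between v and w, so the edge vw crosses no chord of U.

    Hence the edges of the link inside U form a maximal set of non-crossing
    chords of U, in other words a triangulation: neighbours in U are joined, and
    since no edge runs through an inner region, any two of its vertices are
    joined, which is impossible with four or more of them.  The neighbours in U
    give every point of U degree at least 2, except that for the two points next
    to x one also uses the triangles of three consecutive points, which cross
    nothing. *)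

(** * Cyclic order of four points *)

(** Cyclic order of four points as a statement about natural numbers, so that
    it can be transported to positions and decided by linear arithmetic. *)
Definition cyc4 (p q r s : nat) : bool :=
  [|| [&& p < q, q < r & r < s], [&& q < r, r < s & s < p],
      [&& r < s, s < p & p < q] | [&& s < p, p < q & q < r]].

Lemma cyclically_ordered4E n (a b c d : 'I_n) :
  cyclically_ordered [:: a; b; c; d] = cyc4 a b c d.
Proof.
rewrite /cyclically_ordered /cyc4 /=; apply/existsP/idP.
  by case=> [[[|[|[|[|i]]]] //= _]]; rewrite andbT => ->; rewrite ?orbT.
case/or4P=> h; [exists (@Ordinal 4 0 isT) | exists (@Ordinal 4 1 isT) |
  exists (@Ordinal 4 2 isT) | exists (@Ordinal 4 3 isT)]; by rewrite /= andbT.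
Qed.

(** The position of a when [n] is read cyclically starting from x. *)
Definition pos n (x a : 'I_n) : nat := if x <= a then a - x else a + n - x.

Lemma pos_ltE n (x a b : 'I_n) :
  (pos x a < pos x b) =
  if x <= a then (if x <= b then a < b else true)
  else (if x <= b then false else a < b).
Proof.
rewrite /pos; have := (ltn_ord x, ltn_ord a, ltn_ord b) => -[[? ?] ?].
by case: (leqP x a) => ?; case: (leqP x b) => ? /=; lia.
Qed.

(** Cyclic order is invariant under rotation, so x may be taken as the origin. *)
Lemma cyclically_ordered_pos n (x a b c d : 'I_n) :
  cyclically_ordered [:: a; b; c; d] =
  cyc4 (pos x a) (pos x b) (pos x c) (pos x d).
Proof.
rewrite cyclically_ordered4E /cyc4 !pos_ltE.
by case: (leqP x a) => ?; case: (leqP x b) => ?; case: (leqP x c) => ?;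
  case: (leqP x d) => ?; rewrite /= ?andbF ?andbT ?orbF ?orbT; lia.
Qed.

Lemma pos_inj n (x : 'I_n) : injective (pos x).
Proof.
move=> a b; rewrite /pos => h; apply/val_inj => /=; move: h.
by have := (ltn_ord x, ltn_ord a, ltn_ord b) => -[[? ?] ?]; do 2 case: ifP; lia.
Qed.

Lemma pos_self n (x : 'I_n) : pos x x = 0.
Proof. by rewrite /pos leqnn subnn. Qed.

Lemma pos_gt0 n (x a : 'I_n) : (0 < pos x a) = (a != x).
Proof. by rewrite lt0n -{1}(pos_self x) (inj_eq (@pos_inj n x)). Qed.

Lemma pos_lt n (x a : 'I_n) : pos x a < n.
Proof. by rewrite /pos; have := (ltn_ord x, ltn_ord a) => -[? ?]; case: ifP; lia. Qed.

Lemma pos_surj n (x : 'I_n) k : k < n -> exists a, pos x a = k.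
Proof.
move=> kn; have xn := ltn_ord x.
have h : (if x + k < n then x + k else x + k - n) < n by case: ifP; lia.
by exists (Ordinal h); rewrite /pos /=; do 2 case: ifP; lia.
Qed.

Lemma cyc4_rot p q r s : cyc4 p q r s = cyc4 q r s p.
Proof. by rewrite /cyc4 orbC -!orbA. Qed.

Lemma cyclically_ordered_rot n (a b c d : 'I_n) :
  cyclically_ordered [:: a; b; c; d] = cyclically_ordered [:: b; c; d; a].
Proof. by rewrite !cyclically_ordered4E cyc4_rot. Qed.

Lemma cyclically_ordered_irr n (a b c : 'I_n) :
  ~~ cyclically_ordered [:: a; b; a; c].
Proof. by rewrite cyclically_ordered4E /cyc4; lia. Qed.

Lemma cyc4_0 p q r : cyc4 0 p q r = [&& 0 < p, p < q & q < r].
Proof. by rewrite /cyc4 !ltn0 !(andbF, andbT, orbF). Qed.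

Lemma sorted_enum n (U : {set 'I_n}) :
  sorted (fun a b : 'I_n => a < b) (enum U).
Proof.
have := iota_ltn_sorted 0 n; rewrite -val_enum_ord sorted_map => h.
by rewrite /enum_mem -enumT; apply: sorted_filter h => a b c; apply: ltn_trans.
Qed.

(** The boundary of the polygon on U, described without an enumeration: chords of
    U that no chord of U can cross. *)
Lemma cycle_enum n (U : {set 'I_n}) (e : rel 'I_n) : 1 < #|U| ->
  (forall a b, a \in U -> b \in U -> a != b ->
     (forall c d, c \in U -> d \in U -> ~~ cyclically_ordered [:: a; c; b; d]) ->
     e a b) ->
  cycle e (enum U).
Proof.
rewrite cardE => U2 he; have := sorted_enum U.
have memU a : (a \in U) = (a \in enum U) by rewrite mem_enum.
case E: (enum U) memU U2 => [|a s] //= memU s0 srt.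
have tr : transitive (fun b c : 'I_n => b < c) by move=> b c d; apply: ltn_trans.
have lt_nth := @sorted_ltn_nth _ _ tr a (a :: s) srt.
have {}lt_nth i j : i < j -> j <= size s -> nth a (a :: s) i < nth a (a :: s) j.
  by move=> ij js; apply: lt_nth => //; rewrite !inE; apply: leq_trans js; apply: ltnW.
have memP c : c \in U -> exists2 j, j <= size s & c = nth a (a :: s) j.
  by rewrite memU => cs; exists (index c (a :: s)); rewrite ?nth_index // -ltnS index_mem.
rewrite rcons_path; apply/andP; split.
  apply/(pathP a) => i lt_is; have lti := lt_nth i i.+1 (ltnSn i) lt_is.
  apply: he; rewrite ?memU.
  - by rewrite mem_nth // ltnW.
  - by rewrite inE mem_nth ?orbT.
  - by apply: contraTneq lti => /= ->; rewrite ltnn.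
  have nogap c : c \in U -> ~~ (nth a (a :: s) i < c < nth a s i).
    case/memP=> j js ->; apply/negP => /andP[].
    case: (ltngtP i j) => [ij|ji|->]; last by rewrite ltnn.
      by case: (ltngtP i.+1 j) ij => // [/lt_nth/(_ js) /= h _ _|<- _ _] /=;
        rewrite ?ltnn // ltnNge ltnW.
    by have := lt_nth j i ji (ltnW lt_is) => h; rewrite ltnNge ltnW.
  move=> c d /nogap + /nogap; move: lti => /=.
  by rewrite cyclically_ordered4E /cyc4; clear; lia.
have la : nth a (a :: s) (size s) = last a s by rewrite (last_nth a).
apply: he; rewrite ?memU ?mem_last ?mem_head //.
  by have := lt_nth 0 (size s) s0 (leqnn _); rewrite la /=;
    apply: contraTneq => ->; rewrite ltnn.
have bnd c : c \in U -> a <= c <= last a s.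
  case/memP=> j js ->; rewrite -la; apply/andP; split.
    by case: j js => // j js; apply/ltnW/(lt_nth 0).
  by move: js; rewrite leq_eqVlt => /predU1P[->//|js]; apply/ltnW/lt_nth.
move=> c d /bnd hc /bnd hd; move: hc hd; rewrite cyclically_ordered4E /cyc4.
by move: (last a s) => l; clear; lia.
Qed.

(** * Crossing sets *)

Lemma crossingP n (A B : {set 'I_n}) :
  reflect (exists a b c d, [/\ a \in A :\: B, c \in A :\: B, b \in B :\: A,
             d \in B :\: A & cyclically_ordered [:: a; b; c; d]])
          (crossing A B).
Proof.
apply: (iffP existsP) => [[a /andP[aA /existsP[c /andP[cA /existsP[b]]]]]|].
  by case/andP=> bB /existsP[d /andP[dB h]]; exists a, b, c, d.
move=> [a [b [c [d [aA cA bB dB h]]]]]; exists a; rewrite aA.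
apply/existsP; exists c; rewrite cA; apply/existsP; exists b; rewrite bB.
by apply/existsP; exists d; rewrite dB.
Qed.

Lemma crossingC n (A B : {set 'I_n}) : crossing A B = crossing B A.
Proof.
suff imp (C D : {set 'I_n}) : crossing C D -> crossing D C by apply/idP/idP; apply: imp.
case/crossingP=> a [b [c [d [aA cA bB dB]]]]; rewrite cyclically_ordered4E => h.
apply/crossingP; exists b, c, d, a; split=> //.
by rewrite cyclically_ordered4E; move: h; rewrite /cyc4; lia.
Qed.

(** The chord xv separates two points iff one comes before v and one after v when
    reading from x. *)
Lemma crossing_pairP n (x v : 'I_n) (B : {set 'I_n}) : v != x ->
  reflect [/\ x \notin B, v \notin B &
             exists p r, [/\ p \in B, r \in B & pos x p < pos x v < pos x r]]
          (crossing [set x; v] B).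
Proof.
move=> vx; apply: (iffP (crossingP _ _)) => [[a [b [c [d []]]]]|].
  rewrite !inE (cyclically_ordered_pos x).
  move=> /andP[aB aA] /andP[cB cA] /andP[_ bB] /andP[_ dB].
  case/orP: aA aB => /eqP-> aB; case/orP: cA cB => /eqP-> cB;
    rewrite ?pos_self => h.
  - by move: h; clear; rewrite /cyc4; lia.
  - split=> //; exists b, d; split=> //.
    by move: h; clear; rewrite cyc4_0 => /andP[].
  - split=> //; exists d, b; split=> //.
    by move: h; clear; rewrite 2!cyc4_rot cyc4_0 => /andP[].
  - by move: h; clear; rewrite /cyc4; lia.
case=> xB vB [p [r [pB rB h]]].
have out y z : y \in B -> z \notin B -> y != z by move=> yB; apply: contraNneq => <-.
exists x, p, v, r; rewrite !inE xB vB pB rB !eqxx orbT !negb_or !out //; split=> //.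
by rewrite (cyclically_ordered_pos x) pos_self cyc4_0 pos_gt0 out.
Qed.

(** * The link of a point *)

Section Link.
Variables (n : nat) (F : {set {set 'I_n}}) (x : 'I_n).

(** The future vertices of the polygon. *)
Definition compatible : {set 'I_n} :=
  [set v | v != x & [forall B in F, ~~ crossing [set x; v] B]].

Lemma compatible_neq v : v \in compatible -> v != x.
Proof. by rewrite inE => /andP[]. Qed.

Lemma compatible_pos v : v \in compatible -> 0 < pos x v.
Proof. by move/compatible_neq; rewrite pos_gt0. Qed.

Lemma compatible_same_side v B p r : v \in compatible -> B \in F -> x \notin B ->
  v \notin B -> p \in B -> r \in B -> ~~ (pos x p < pos x v < pos x r).
Proof.
rewrite inE => /andP[vx /forall_inP h] BF xB vB pB rB; apply/negP => hp.
by move: (h _ BF); apply/negP/negPn/crossing_pairP => //; split=> //; exists p, r.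
Qed.

Lemma incompatibleP v : v != x -> v \notin compatible ->
  exists B p r, [/\ B \in F, x \notin B, v \notin B, p \in B &
                    r \in B /\ pos x p < pos x v < pos x r].
Proof.
move=> vx; rewrite inE vx /= => /forall_inPn[B BF]; rewrite negbK.
by case/(crossing_pairP _ vx) => xB vB [p [r [pB rB h]]]; exists B, p, r.
Qed.

Hypothesis maxF : maximal_ws_family F.

Let G := link_graph F x.

Lemma ws_triangle B : B \in F -> #|B| = 3.
Proof.
by move=> BF; case/maxsetP: maxF => /andP[/forall_inP h _] _; apply/eqP; apply: h.
Qed.

Lemma ws_noncrossing (A B : {set 'I_n}) : A \in F -> B \in F -> ~~ crossing A B.
Proof.
by move=> AF BF; case/maxsetP: maxF => /andP[_ /forall_inP h] _; apply: (forall_inP (h A AF)).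
Qed.

Lemma maximal_mem (A : {set 'I_n}) : #|A| = 3 ->
  (forall B, B \in F -> ~~ crossing A B) -> A \in F.
Proof.
move=> A3 hA; have [_ max] := maxsetP maxF.
rewrite -(max (A |: F)) ?setU11 ?subsetUr //; apply/andP; split.
  by apply/forall_inP => B /setU1P[->|/ws_triangle/eqP //]; apply/eqP.
have AA : ~~ crossing A A.
  by apply/negP => /crossingP[a [b [c [d []]]]]; rewrite setDv inE.
apply/forall_inP => B /setU1P[->|BF]; apply/forall_inP => C /setU1P[->|CF] //.
- exact: hA.
- by rewrite crossingC hA.
- exact: ws_noncrossing.
Qed.

Lemma link_adjE a b : adj G a b = uniq [:: x; a; b] && ([set x; a; b] \in F).
Proof. by rewrite /G /=; congr andb; rewrite inE !inE eqxx /= andbT. Qed.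

Lemma link_adj_sym a b : adj G a b -> adj G b a.
Proof.
rewrite !link_adjE setUAC => /andP[+ ->].
by rewrite andbT /= !inE !negb_or; move=> /and3P[/andP[-> ->]]; rewrite eq_sym => ->.
Qed.

Lemma card_triangle (a b c : 'I_n) : uniq [:: a; b; c] -> #|[set a; b; c]| = 3.
Proof.
move=> /card_uniqP h; transitivity #|[:: a; b; c]| => //; apply: eq_card => z.
by rewrite !inE orbA.
Qed.

Lemma link_adj_neq a b : adj G a b -> [/\ a != x, b != x & a != b].
Proof.
rewrite link_adjE /= !inE negb_or => /andP[/and3P[/andP[? ?] ? _] _].
by split; rewrite // eq_sym.
Qed.

Lemma link_adj_vert a b : adj G a b -> a \in vert G.
Proof.
move=> ab; have [ax _ _] := link_adj_neq ab.
rewrite inE ax; apply/existsP; exists [set x; a; b].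
by move: ab; rewrite /= => /andP[_ ->]; rewrite !inE eqxx orbT.
Qed.

(** A member of F through x and v is the triangle of an edge at v. *)
Lemma star_adj C v : C \in F -> x \in C -> v \in C -> v != x ->
  exists2 w, adj G v w & C = [set x; v; w].
Proof.
move=> CF xC vC vx.
have : #|C :\ x :\ v| == 1.
  have := ws_triangle CF; rewrite (cardsD1 x) xC (cardsD1 v (C :\ x)) !inE vx vC.
  by rewrite /= => ?; lia.
case/cards1P=> w hw; have CE : C = [set x; v; w].
  rewrite -(setD1K xC); have : v \in C :\ x by rewrite !inE vx.
  by move/setD1K <-; rewrite hw setUA.
exists w => //; rewrite link_adjE -CE CF andbT.
have : w \in C :\ x :\ v by rewrite hw set11.
rewrite !inE => /and3P[wv wx _].
by rewrite /= !inE negb_or eq_sym vx eq_sym wx eq_sym wv.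
Qed.

Lemma vert_adj v : v \in vert G -> exists w, adj G v w.
Proof.
rewrite inE => /andP[vx /existsP[C /andP[]]]; rewrite inE => /andP[CF xC] vC.
by have [w ? _] := star_adj CF xC vC vx; exists w.
Qed.

(** * Points outside the polygon *)

(** Otherwise the chord xv would make {x, v, w} cross B. *)
Lemma adj_side v w B p r : adj G v w -> B \in F -> x \notin B -> v \notin B ->
  p \in B -> r \in B -> pos x p < pos x v < pos x r -> w = p \/ w = r.
Proof.
move=> vw BF xB vB pB rB h.
have [->|wp] := eqVneq w p; first by left.
have [->|wr] := eqVneq w r; first by right.
move: vw; rewrite link_adjE => /andP[_ AF].
have px : p != x by apply: contraNneq xB => <-.
have rx : r != x by apply: contraNneq xB => <-.
have pv : p != v by apply: contraNneq vB => <-.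
have rv : r != v by apply: contraNneq vB => <-.
case/negP: (ws_noncrossing AF BF); apply/crossingP; exists x, p, v, r; split.
- by rewrite !inE xB eqxx.
- by rewrite !inE vB eqxx orbT.
- by rewrite !inE pB !negb_or px pv eq_sym wp.
- by rewrite !inE rB !negb_or rx rv eq_sym wr.
- by rewrite (cyclically_ordered_pos x) pos_self cyc4_0 pos_gt0 px.
Qed.

(** A triangle B with points on both sides of v has exactly one point on one of
    the sides, and every edge at v ends there: comparing the two pairs of points
    that have v between them leaves only this common endpoint. *)
Lemma incompatible_adj_uniq v w w' : v \notin compatible ->
  adj G v w -> adj G v w' -> w = w'.
Proof.
move=> vU vw vw'; have [vx _ _] := link_adj_neq vw.
have [B [p [r [BF xB vB pB [rB h]]]]] := incompatibleP vx vU.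
have /andP[pv vr] := h.
(* q is the third point of B. *)
have [q] : exists q, q \in B :\ p :\ r.
  apply/card_gt0P; have := ws_triangle BF.
  rewrite (cardsD1 p) pB (cardsD1 r (B :\ p)).
  by case: (r \in _) (#|_|) => -[].
rewrite !inE => /and3P[/eqP qr /eqP qp qB].
have side s t := adj_side vw BF xB vB (p := s) (r := t).
have side' s t := adj_side vw' BF xB vB (p := s) (r := t).
have := side p r pB rB h; have := side' p r pB rB h.
case: (ltngtP (pos x q) (pos x v)) => [lt|gt|/pos_inj e]; last by rewrite -e qB in vB.
  have h' : pos x q < pos x v < pos x r by rewrite lt.
  have := side q r qB rB h'; have := side' q r qB rB h'.
  by do 4 case=> ?; congruence.
have h' : pos x p < pos x v < pos x q by rewrite pv.
have := side p q pB qB h'; have := side' p q pB qB h'.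
by do 4 case=> ?; congruence.
Qed.

(** If both ends of an edge vw, with w before v, were outside U, there would be
    members B containing w but not v with a point after v, and B' containing v
    but not w with a point before w.  Then B' and B cross. *)
Lemma incompatible_adj_compatible v w : v \notin compatible -> adj G v w ->
  w \in compatible.
Proof.
move=> vU vw; apply/negPn/negP => wU.
wlog lt : v w vU wU vw / pos x w < pos x v.
  move=> IH; have [_ _ vNw] := link_adj_neq vw.
  case: (ltngtP (pos x w) (pos x v)) => [|lt|/pos_inj e].
  - exact: IH vw.
  - exact: (IH w v wU vU (link_adj_sym vw)).
  - by rewrite e eqxx in vNw.
have [vx wx vNw] := link_adj_neq vw.
have [B [p [r [BF xB vB pB [rB h]]]]] := incompatibleP vx vU.
have [B' [p' [r' [BF' xB' wB' pB' [rB' h']]]]] := incompatibleP wx wU.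
have /andP[pv vr] := h; have /andP[pw wr] := h'.
have wp : w = p.
  case: (adj_side vw BF xB vB pB rB h) => // e.
  by move: lt vr; rewrite e; clear; lia.
have vr' : v = r'.
  case: (adj_side (link_adj_sym vw) BF' xB' wB' pB' rB' h') => // e.
  by move: lt pw; rewrite e; clear; lia.
subst p r'; case/negP: (ws_noncrossing BF' BF); apply/crossingP.
exists p', w, v, r; split; rewrite ?inE ?vB ?wB' ?pB ?rB' //.
- rewrite pB' andbT; apply/negP => p'B.
  have h1 : pos x p' < pos x v < pos x r by rewrite (ltn_trans pw lt).
  by case: (adj_side vw BF xB vB p'B rB h1) => e; move: pw wr lt vr; rewrite e; clear; lia.
- rewrite rB andbT; apply/negP => rB''.
  have h1 : pos x p' < pos x w < pos x r by rewrite pw (ltn_trans lt vr).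
  by case: (adj_side (link_adj_sym vw) BF' xB' wB' pB' rB'' h1) => e;
    move: pw wr lt vr; rewrite e; clear; lia.
- by rewrite (cyclically_ordered_pos x) /cyc4 pw lt vr.
Qed.

(** Let B be a member of F crossing {x, v}.  Then w is in B, and a point a
    between v and w also has points of B on both sides.  It is not in B, since
    a and a point of B beyond v would be a pair excluded by adj_side. *)
Lemma no_compatible_between v w a : v \notin compatible -> adj G v w ->
  a \in compatible ->
  ~~ (minn (pos x v) (pos x w) < pos x a < maxn (pos x v) (pos x w)).
Proof.
move=> vU vw aU; apply/negP => ha; have [vx wx vNw] := link_adj_neq vw.
have [B [p [r [BF xB vB pB [rB h]]]]] := incompatibleP vx vU.
have /andP[pv vr] := h.
have wpr := adj_side vw BF xB vB pB rB h.
have aB : a \notin B.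
  apply/negP => aB; have [lt|ge] := ltnP (pos x a) (pos x v).
    have h1 : pos x a < pos x v < pos x r by rewrite lt.
    by case: (adj_side vw BF xB vB aB rB h1) => e; move: ha lt pv vr; rewrite e; clear; lia.
  have lt : pos x v < pos x a.
    by rewrite ltn_neqAle ge andbT; apply: contraNneq vB => /pos_inj ->.
  have h1 : pos x p < pos x v < pos x a by rewrite pv.
  by case: (adj_side vw BF xB vB pB aB h1) => e; move: ha lt pv vr; rewrite e; clear; lia.
have /negP := compatible_same_side aU BF xB aB pB rB; apply.
by case: wpr => e; move: ha pv vr; rewrite e; clear; lia.
Qed.

(** * Chords of the polygon *)

(** By maximality of F, it suffices that {x, a, b} crosses no B in F, that is, no
    two of x, a, b separate two points of B.  For xa and xb this is what it means
    that a and b lie in U; for ab it follows from these when B omits x, and from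
    the assumption on edges when B contains x. *)
Lemma compatible_adj a b : a \in compatible -> b \in compatible -> a != b ->
  (forall c d, c \in compatible -> d \in compatible -> adj G c d ->
     ~~ cyclically_ordered [:: a; c; b; d]) -> adj G a b.
Proof.
move=> aU bU ab hcd; rewrite link_adjE.
have ax := compatible_neq aU; have bx := compatible_neq bU.
have u : uniq [:: x; a; b] by rewrite /= !inE negb_or eq_sym ax eq_sym bx ab.
rewrite u; apply: maximal_mem; first exact: card_triangle.
(* An edge with an end outside U cannot separate a from b, as one of its sides
   has no point of U; so no edge at all crosses ab. *)
have edge c d : adj G c d -> ~~ cyclically_ordered [:: a; c; b; d].
  move=> cd; have [cU|cU] := boolP (c \in compatible); last first.
    have := no_compatible_between cU cd aU; have := no_compatible_between cU cd bU.
    by rewrite (cyclically_ordered_pos x) /cyc4; clear; lia.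
  have [dU|dU] := boolP (d \in compatible); first exact: hcd.
  have dc := link_adj_sym cd.
  have := no_compatible_between dU dc aU; have := no_compatible_between dU dc bU.
  by rewrite (cyclically_ordered_pos x) /cyc4; clear; lia.
move=> B BF; apply/negP => /crossingP[s [p [t [r []]]]].
rewrite !inE -!orbA !negb_or.
move=> /andP[sB sA] /andP[tB tA] /andP[/and3P[px _ _] pB] /andP[/and3P[rx _ _] rB].
(* The chords xa and xb do not separate p from r. *)
have apart v : v \in compatible -> v \notin B -> x \notin B ->
    ~~ cyclically_ordered [:: x; p; v; r] /\ ~~ cyclically_ordered [:: x; r; v; p].
  move=> vU vB xB; rewrite !(cyclically_ordered_pos x) pos_self !cyc4_0.
  have /negPf -> := compatible_same_side vU BF xB vB pB rB.
  by have /negPf -> := compatible_same_side vU BF xB vB rB pB; rewrite !andbF.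
(* Neither does ab: if x is in B, then p = r or pr is an edge of the link;
   otherwise a chord ab separating p from r would have xa or xb do so, too. *)
have separated : a \notin B -> b \notin B ->
    ~~ (cyclically_ordered [:: a; p; b; r] || cyclically_ordered [:: a; r; b; p]).
  move=> aB bB; have [xB|xB] := boolP (x \in B).
    have [w pw CE] := star_adj BF xB pB px.
    have [->|rNp] := eqVneq r p; first by
      rewrite orbb cyclically_ordered_rot cyclically_ordered_irr.
    have {CE} rw : r = w.
      by move: rB; rewrite CE !inE (negPf rx) (negPf rNp) => /eqP.
    by rewrite negb_or rw edge // edge // link_adj_sym.
  have := pos_gt0 x p; have := pos_gt0 x r; rewrite px rx.
  have [] := apart a aU aB xB; have [] := apart b bU bB xB.
  rewrite !(cyclically_ordered_pos x) pos_self !cyc4_0 /cyc4.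
  by clear; lia.
case/or3P: sA sB => /eqP-> sB; case/or3P: tA tB => /eqP-> tB h.
- by move: h; rewrite (negPf (cyclically_ordered_irr _ _ _)).
- by have [/negP[]] := apart a aU tB sB.
- by have [/negP[]] := apart b bU tB sB.
- by have [_ /negP[]] := apart a aU sB tB; rewrite 2!cyclically_ordered_rot.
- by move: h; rewrite (negPf (cyclically_ordered_irr _ _ _)).
- by case/negP: (separated sB tB); rewrite h.
- by have [_ /negP[]] := apart b bU sB tB; rewrite 2!cyclically_ordered_rot.
- by case/negP: (separated tB sB); rewrite orbC 2!cyclically_ordered_rot h.
- by move: h; rewrite (negPf (cyclically_ordered_irr _ _ _)).
Qed.

(** * The points next to x and the degrees *)

Lemma first_compatible e : pos x e = 1 -> e \in compatible.
Proof.
move=> e1; have ex : e != x by rewrite -pos_gt0 e1.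
rewrite inE ex; apply/forall_inP => B BF; apply/crossing_pairP => //.
case=> xB _ [p [r [pB _]]]; rewrite e1 ltnS leqn0 => /andP[/eqP p0 _].
by move: xB; rewrite -(pos_inj (etrans p0 (esym (pos_self x)))) pB.
Qed.

Lemma last_compatible e : 0 < pos x e -> pos x e = n.-1 -> e \in compatible.
Proof.
rewrite pos_gt0 => ex en.
rewrite inE ex; apply/forall_inP => B BF; apply/crossing_pairP => //.
case=> _ _ [p [r [_ _ /andP[_]]]]; rewrite en; have := pos_lt x r.
by clear; lia.
Qed.

(** Three cyclically consecutive points, x at one end, cross nothing: two of them
    have no outside point on one of the arcs between them. *)
Lemma end_adj y z : uniq [:: x; y; z] ->
  (forall q, q \notin [set x; y; z] -> pos x y < pos x q /\ pos x z < pos x q) \/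
  (forall q, q \notin [set x; y; z] -> pos x q < pos x y /\ pos x q < pos x z) ->
  adj G y z.
Proof.
move=> u side; rewrite link_adjE u; apply: maximal_mem; first exact: card_triangle.
move=> B _; apply/crossingP => -[s [p [t [r []]]]].
rewrite 2!in_setD => /andP[_ sA] /andP[_ tA].
rewrite 2!in_setD => /andP[pA _] /andP[rA _].
have pos0 q : q \notin [set x; y; z] -> 0 < pos x q.
  by rewrite pos_gt0; apply: contraNneq => ->; rewrite !inE eqxx.
have p0 := pos0 p pA; have r0 := pos0 r rA; rewrite (cyclically_ordered_pos x).
move: sA tA; rewrite !inE -!orbA => /or3P[] /eqP-> /or3P[] /eqP->; rewrite ?pos_self;
  case: side => side; move: p0 r0 (side p pA) (side r rA); clear;
  rewrite /cyc4; lia.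
Qed.

(** A point of U is joined to its two neighbours in U.  These may coincide when
    u is next to x; there the triangle of three consecutive points that starts
    or ends with x, u supplies a neighbour at position 2 or n - 2, and this is a
    new one since n > 3. *)
Lemma compatible_degree u : 3 < n -> u \in compatible -> 1 < degree G u.
Proof.
move=> n3 uU.
suff [y [z [uy uz yz]]] : exists y z, [/\ adj G u y, adj G u z & y != z].
  apply/card_gt1P; exists y, z; split=> //.
    by rewrite in_set uy (link_adj_vert (link_adj_sym uy)).
  by rewrite in_set uz (link_adj_vert (link_adj_sym uz)).
have [e e1] : exists e, pos x e = 1 by apply: pos_surj; lia.
have [l ln] : exists l, pos x l = n.-1 by apply: pos_surj; lia.
have eU := first_compatible e1.
have lU : l \in compatible by apply: last_compatible; lia.
have neq a b : pos x a <> pos x b -> a != b by move=> h; apply/eqP => /(congr1 (pos x)).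
have neq0 a : 0 < pos x a -> x != a by rewrite pos_gt0 eq_sym.
have el : adj G e l.
  apply: compatible_adj => // [|c d /compatible_pos c0 /compatible_pos d0 _].
    by apply: neq; lia.
  have := pos_lt x c; have := pos_lt x d; rewrite (cyclically_ordered_pos x) e1 ln /cyc4.
  by move: c0 d0; clear; lia.
have [u1|u1] := eqVneq (pos x u) 1.
  have {u1} -> : u = e by apply: (@pos_inj _ x); rewrite u1.
  have [f f2] : exists f, pos x f = 2 by apply: pos_surj; lia.
  exists l, f; split=> //; last by apply: neq; lia.
  apply: end_adj.
    by rewrite /= !inE negb_or andbT !neq0 ?neq ?e1 ?f2.
  left=> q; rewrite !inE !negb_or -!(inj_eq (@pos_inj _ x)) e1 f2 pos_self.
  by clear; lia.
have [un|un] := eqVneq (pos x u) n.-1.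
  have {u1 un} -> : u = l by apply: (@pos_inj _ x); rewrite un.
  have [f f2] : exists f, pos x f = n.-2 by apply: pos_surj; lia.
  exists e, f; split; [exact: link_adj_sym | | by apply: neq; lia].
  apply: end_adj.
    by rewrite /= !inE negb_or andbT !neq0 ?neq ?ln ?f2 //; lia.
  right=> q; rewrite !inE !negb_or -!(inj_eq (@pos_inj _ x)) ln f2 pos_self.
  by have := pos_lt x q; move: n3; clear; lia.
have u0 := compatible_pos uU; have ult := pos_lt x u.
have eu : (e \in compatible) && (pos x e < pos x u) by rewrite eU e1; lia.
have lu : (l \in compatible) && (pos x u < pos x l) by rewrite lU ln; lia.
(* y and z are the neighbours of u in U. *)
case: (@arg_maxnP _ e (fun v => (v \in compatible) && (pos x v < pos x u)) (pos x) eu).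
move=> y /andP[yU yu] ymax.
case: (@arg_minnP _ l (fun v => (v \in compatible) && (pos x u < pos x v)) (pos x) lu).
move=> z /andP[zU zu] zmin.
exists y, z; split; last by apply: neq; lia.
- apply: compatible_adj => // [|c d cU dU _]; first by apply: neq; lia.
  have := ymax c; have := ymax d; rewrite cU dU (cyclically_ordered_pos x) /cyc4.
  by move: yu; clear; lia.
- apply: compatible_adj => // [|c d cU dU _]; first by apply: neq; lia.
  have := zmin c; have := zmin d; rewrite cU dU (cyclically_ordered_pos x) /cyc4.
  by move: zu; clear; lia.
Qed.

Lemma compatible_vert u : 3 < n -> u \in compatible -> u \in vert G.
Proof.
move=> n3 /(compatible_degree n3)/ltnW/card_gt0P[w].
by rewrite in_set => /andP[_ /link_adj_vert].
Qed.

Lemma incompatible_degree v : v \notin compatible -> degree G v <= 1.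
Proof.
move=> vU; apply/card_le1_eqP => w w'; rewrite !in_set => /andP[_ vw] /andP[_ vw'].
by rewrite (incompatible_adj_uniq vU vw vw').
Qed.

Lemma deg_ge2_compatible : 3 < n -> deg_ge2 G = compatible.
Proof.
move=> n3; apply/setP => v; rewrite in_set; apply/andP/idP => [[_]|vU].
  by apply: contraTT => /incompatible_degree; rewrite -leqNgt.
by split; [exact: compatible_vert | exact: compatible_degree].
Qed.

(** * The triangulation *)

Lemma link_noncrossing : noncrossing G.
Proof.
move=> a b c d ab cd; apply/negP => h.
move: (ab) (cd); rewrite !link_adjE => /andP[_ AF] /andP[_ CF].
case/negP: (ws_noncrossing AF CF); apply/crossingP; exists a, c, b, d.
have [ax bx _] := link_adj_neq ab; have [cx dx _] := link_adj_neq cd.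
have [ac ad bc bd] : [/\ a != c, a != d, b != c & b != d].
  by move: h; rewrite cyclically_ordered4E -!(inj_eq val_inj) /cyc4 /=; clear; split; lia.
split=> //; rewrite !inE !negb_or eqxx ?orbT ?ax ?bx ?cx ?dx ?ac ?ad ?bc ?bd //.
- by rewrite eq_sym ac eq_sym bc.
- by rewrite eq_sym ad eq_sym bd.
Qed.

Lemma compatible_card : 3 < n -> 1 < #|compatible|.
Proof.
move=> n3; have [e e1] : exists e, pos x e = 1 by apply: pos_surj; lia.
have [l ln] : exists l, pos x l = n.-1 by apply: pos_surj; lia.
apply/card_gt1P; exists e, l; split; first exact: first_compatible.
  by apply: last_compatible; lia.
by apply/eqP => /(congr1 (pos x)); lia.
Qed.

(** No edge separates two vertices of an inner region, so all pairs of its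
    vertices are edges; with four vertices, a diagonal would separate two
    others. *)
Lemma compatible_region_card (W : {set 'I_n}) :
  inner_region (induced G compatible) W -> #|W| = 3.
Proof.
case=> /subsetP WU W3 _ sep; apply/eqP; rewrite eqn_leq W3 andbT leqNgt.
have {}WU w : w \in W -> w \in compatible by move/WU; rewrite inE => /andP[].
apply/negP; rewrite cardE; have := sorted_enum W.
have memW a : (a \in W) = (a \in enum W) by rewrite mem_enum.
case: (enum W) memW => [|a [|b [|c [|d s]]]] //= memW /and4P[ab bc cd _] _.
have [aW bW cW dW] : [/\ a \in W, b \in W, c \in W & d \in W].
  by rewrite !memW !inE !eqxx !orbT.
have ac : adj G a c.
  apply: compatible_adj; rewrite ?WU //.
    by apply: contraTneq (ltn_trans ab bc) => ->; rewrite ltnn.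
  move=> p q pU qU pq; rewrite cyclically_ordered_rot; apply: sep => //=.
  by rewrite pU qU.
have /negP[] := sep a c b d (introT and3P (And3 (WU _ aW) (WU _ cW) ac)) bW dW.
by rewrite cyclically_ordered4E /cyc4 ab bc cd.
Qed.

End Link.

Theorem theorem1p15 (n : nat) (hn : 3 < n) (F : {set {set 'I_n}})
    (hF : maximal_ws_family F) (x : 'I_n) :
  let G := link_graph F x in
  polygon_triangulation #|deg_ge2 G| (induced G (deg_ge2 G)) /\
  (forall v : 'I_n, v \in vert G -> v \notin deg_ge2 G ->
     degree G v = 1 /\ (exists2 w : 'I_n, w \in deg_ge2 G & adj G v w)).
Proof.
move=> G; rewrite (deg_ge2_compatible x hF hn); set U := compatible F x.
have vertU : vert (induced G U) = U.
  by apply/setIidPr/subsetP => u; apply: compatible_vert.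
split; [split | move=> v vG vU].
- exact: compatible_card.
- by rewrite vertU.
- rewrite /boundary_joined vertU; apply: cycle_enum; first exact: compatible_card.
  move=> a b aU bU ab sep; rewrite /= aU bU; apply: compatible_adj => // c d cU dU _.
  exact: sep.
- by move=> a b c d /and3P[_ _ ab] /and3P[_ _ cd]; apply: link_noncrossing ab cd.
- by move=> W; apply: compatible_region_card.
- have [w vw] := vert_adj hF vG; split; last first.
    by exists w => //; apply: incompatible_adj_compatible vw.
  apply/eqP; rewrite eqn_leq incompatible_degree //; apply/card_gt0P; exists w.
  by rewrite in_set vw (link_adj_vert (link_adj_sym vw)).
Qed.
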